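(* Let $h:\mathcal{S}\to\mathbb{R}$ be a harmonic function on the Sierpiński gasket, and let $G_h=\{(\mathbf{x},h(\mathbf{x})):\mathbf{x}\in\mathcal{S}\}\subset\mathbb{R}^3$ be its graph. Then the (upper) box dimension of $G_h$ is less than or equal to $\frac{\log(18/5)}{\log2}\approx1.8479$, that is, $\overline{\dim}_B(G_h)\le\frac{\log(18/5)}{\log 2}$.
   Context: Let $\mathcal{S}_0=\{q_1,q_2,q_3\}\subset\mathbb{R}^2$ be three points equidistant from each other, $L_i(x)=\frac12(x-q_i)+q_i$ for $i=1,2,3$, and let $\mathcal{S}\subset\mathbb{R}^2$ be the Sierpiński gasket, i.e. the unique nonempty compact set with $\mathcal{S}=\bigcup_{i=1}^3L_i(\mathcal{S})$. $\Sigma^{(m)}$ is the set of words of length $m$ in the symbols $1,2,3$; for $\omega=w_1\cdots w_m$, $L_\omega=L_{w_1}\circ\cdots\circ L_{w_m}$ (identity for the empty word). Let $\mathcal{S}^{(m)}=\bigcup_{\omega\in\Sigma^{(m)}}L_\omega(\mathcal{S}_0)$; for $x,y\in\mathcal{S}^{(m)}$ write $x\sim_my$ if $x\ne y$ both belong to the same cell $L_\omega(\mathcal{S}_0)$ for some $\omega\in\Sigma^{(m)}$. For continuous $u:\mathcal{S}\to\mathbb{R}$ put $\mathcal{E}^{(m)}(u)=\left(\frac53\right)^m\sum_{x\sim_my}|u(x)-u(y)|^2$ (each unordered pair counted once). A continuous function $u:\mathcal{S}\to\mathbb{R}$ is harmonic if $\mathcal{E}^{(m+1)}(u)=\mathcal{E}^{(m)}(u)$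 for every $m\ge0$. Equivalently, its values at vertices are determined by $u(q_1),u(q_2),u(q_3)$ through the ''$\frac15$–$\frac25$'' rule $u(L_{\omega}(L_i(q_j)))=\frac25u(L_\omega(q_i))+\frac25u(L_\omega(q_j))+\frac15u(L_\omega(q_k))$ for every word $\omega$ and every permutation $(i,j,k)$ of $(1,2,3)$. For a nonempty bounded $F\subset\mathbb{R}^3$, let $N_\delta(F)$ be the least number of sets of diameter at most $\delta$ covering $F$; $\overline{\dim}_B(F)=\limsup_{\delta\to0^+}\frac{\log N_\delta(F)}{-\log\delta}$. *)

(* Defs.v *)
From HB Require Import structures.
From mathcomp Require Import all_boot all_order all_algebra.
From mathcomp Require Import all_classical all_reals all_analysis.

Set Implicit Arguments.
Unset Strict Implicit.
Unset Printing Implicit Defensive.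

Import Order.TTheory GRing.Theory Num.Theory.
Import numFieldNormedType.Exports.

Local Open Scope classical_set_scope.
Local Open Scope ring_scope.

Section Metric.
Context {R : realType} {n : nat}.
Implicit Types (x y : 'rV[R]_n) (A F : set 'rV[R]_n) (d : R) (k : nat).

(* The library norm on 'rV[R]_n is the sup norm, hence this explicit
   Euclidean distance; both induce the same topology. *)
Definition eucl_dist x y : R := Num.sqrt (\sum_(i < n) (x 0 i - y 0 i) ^+ 2).

(* The diameter of the empty set is -oo, so that it is at most any real. *)
Definition diam A : \bar R :=
  ereal_sup [set (eucl_dist p.1 p.2)%:E | p in A `*` A].

Definition covered_by d F k : Prop :=
  exists U : 'I_k -> set 'rV[R]_n,
    (forall i, (diam (U i) <= d%:E)%E) /\ F `<=` \bigcup_i U i.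

(* A nonempty set of naturals has a least element, so this infimum is attained
   as soon as F has a finite cover; it is +oo otherwise. *)
Definition covering_number d F : \bar R :=
  ereal_inf [set k%:R%:E | k in [set k : nat | covered_by d F k]].

Definition upper_box_dim F : \bar R :=
  limf_esup (fun d : R => (lne (covering_number d F) / (- ln d)%:E)%E) 0^'+.

End Metric.

Section Gasket.
Context {R : realType}.
Local Notation plane := 'rV[R]_2.
Implicit Types (q : 'I_3 -> plane) (S : set plane) (u : plane -> R) (m : nat).

Definition equidistant q : Prop :=
  injective q /\
  forall i j k l, i != j -> k != l -> eucl_dist (q i) (q j) = eucl_dist (q k) (q l).

Definition half_contraction q (i : 'I_3) (x : plane) : plane :=
  2^-1 *: (x - q i) + q i.

Definition word_map q (w : seq 'I_3) (x : plane) : plane :=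
  foldr (half_contraction q) x w.

Definition is_gasket q S : Prop :=
  [/\ S !=set0, compact S & S = \bigcup_i (half_contraction q i @` S)].

Definition cell q (w : seq 'I_3) : set plane := word_map q w @` range q.

Definition vertices q m : set plane := \bigcup_(w : m.-tuple 'I_3) cell q w.

Definition neighbors q m (x y : plane) : Prop :=
  [/\ vertices q m x, vertices q m y, x != y &
      exists w : m.-tuple 'I_3, cell q w x /\ cell q w y].

(* The sum is over ordered pairs of points; the factor 1/2 makes each unordered
   pair count once.  The index set is finite, so the sum over it is the
   genuine one (over an infinite support it would be 0 by convention). *)
Definition energy q m u : R :=
  (5 / 3) ^+ m *
  (2^-1 * \sum_(p \in [set p : plane * plane | neighbors q m p.1 p.2])
            `|u p.1 - u p.2| ^+ 2).

(* A function on S is represented by a function on the plane; only its values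
   on S matter, as the vertices of all levels lie in S. *)
Definition harmonic_on q S u : Prop :=
  {within S, continuous u} /\ forall m, energy q m.+1 u = energy q m u.

Definition graph_on S u : set 'rV[R]_3 :=
  (fun x => row_mx x (u x)%:M : 'rV[R]_(2 + 1)) @` S.

End Gasket.

(* Main.v *)
(* The cells of a given level share no edge, so the level-[m] energy is the sum
   over words of the energies of the cells.  Subdividing one cell multiplies its
   minimal energy by 3/5, and the excess is a definite quadratic form in the
   deviations from the 1/5-2/5 rule; hence equality of all energies forces that
   rule.  The rule contracts the oscillation on vertices by 3/5 per level and
   obeys the maximum principle, so over a cell of level [m], of diameter of order
   [2^-m], the graph has height of order [(3/5)^m].  It is covered by
   [3^m (6/5)^m = (18/5)^m] sets of diameter of order [2^-m], up to a constant. *)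
Require Import Defs.
From mathcomp Require Import all_boot all_order all_algebra.
From mathcomp Require Import all_classical all_reals all_analysis.
From mathcomp Require Import ring lra.
Import Order.TTheory GRing.Theory Num.Theory.
Import numFieldNormedType.Exports.
Local Open Scope classical_set_scope.
Local Open Scope ring_scope.

(** * Words, cells and barycentric coordinates *)

Lemma ord3_ind (P : 'I_3 -> Prop) : P (inord 0) -> P (inord 1) -> P (inord 2) ->
  forall i, P i.
Proof.
move=> P0 P1 P2 i; rewrite -(inord_val i).
by case: i => [[|[|[|//]]] ?].
Qed.

Lemma big_ord3 {R : realType} (F : 'I_3 -> R) :
  \sum_i F i = F (inord 0) + F (inord 1) + F (inord 2).
Proof.
rewrite !big_ord_recl big_ord0 addr0 addrA.
by congr (F _ + F _ + F _); apply/val_inj; rewrite /= inordK.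
Qed.

Lemma half_contractionE {R : realType} (q : 'I_3 -> 'rV[R]_2) i x :
  half_contraction q i x = 2^-1 *: (x + q i).
Proof.
by apply/rowP => k; rewrite /half_contraction !mxE; field.
Qed.

Lemma word_map_cat {R : realType} (q : 'I_3 -> 'rV[R]_2) v w x :
  word_map q (v ++ w) x = word_map q v (word_map q w x).
Proof. by rewrite /word_map foldr_cat. Qed.

Lemma word_mapB {R : realType} (q : 'I_3 -> 'rV[R]_2) w x y :
  word_map q w x - word_map q w y = 2^-1 ^+ size w *: (x - y).
Proof.
elim: w => [|i w IH] /=; first by rewrite expr0 scale1r.
by rewrite !half_contractionE -scalerBr opprD addrACA subrr addr0 IH scalerA exprS.
Qed.

Definition sqdist {R : realType} (x y : 'rV[R]_2) : R :=
  \sum_(i < 2) (x 0 i - y 0 i) ^+ 2.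

(* Affine in x because the quadratic parts of the squared distances cancel. *)
Definition bary {R : realType} (q : 'I_3 -> 'rV[R]_2) (D : R) (i : 'I_3)
    (x : 'rV[R]_2) : R :=
  (\sum_(j < 3) sqdist x (q j) - 3 * sqdist x (q i) + D) / (3 * D).

Lemma bary_half {R : realType} (q : 'I_3 -> 'rV[R]_2) D i x y : D != 0 ->
  bary q D i (2^-1 *: (x + y)) = (bary q D i x + bary q D i y) / 2.
Proof.
move=> D0; rewrite /bary /sqdist !big_ord_recl !big_ord0 !mxE.
by field.
Qed.

Lemma equidistant_sqdist {R : realType} (q : 'I_3 -> 'rV[R]_2) :
  equidistant q ->
  exists2 D, 0 < D & forall i j, sqdist (q i) (q j) = if i == j then 0 else D.
Proof.
move=> [qinj qd].
have ge0 x y : 0 <= sqdist x y :> R by apply: sumr_ge0 => k _; exact: sqr_ge0.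
exists (sqdist (q ord0) (q ord_max)).
  rewrite lt_neqAle ge0 andbT eq_sym; apply/eqP => s0.
  have /qinj // : q ord0 = q ord_max.
  move: s0 => /eqP; rewrite psumr_eq0; last by move=> k _; exact: sqr_ge0.
  move=> /allP s0; apply/rowP => k; apply/eqP.
  by have := s0 k (mem_index_enum k); rewrite sqrf_eq0 subr_eq0.
move=> i j; case: eqP => [->|/eqP ij].
  by rewrite /sqdist big1 // => k _; rewrite subrr expr0n.
by apply/eqP; rewrite -eqr_sqrt //; apply/eqP/(qd i j ord0 ord_max).
Qed.

Lemma bary_vertex {R : realType} (q : 'I_3 -> 'rV[R]_2) D i j : 0 < D ->
  (forall i j, sqdist (q i) (q j) = if i == j then 0 else D) ->
  bary q D i (q j) = (i == j)%:R.
Proof.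
move=> D0 qD; have D1 : D != 0 by rewrite gt_eqF.
rewrite /bary !big_ord_recl big_ord0 !qD.
by case: i => [[|[|[|//]]] ?]; case: j => [[|[|[|//]]] ?]; rewrite /= ?eqxx /=; field.
Qed.

(* The edge fixes the translate, hence the whole triangle.  The [a]-th
   coordinate of the [a]-th vertex is then more than [2^-1] when the word starts
   with [a], and at most [2^-1] otherwise: the letters can be read off. *)
Lemma word_edge_inj {R : realType} (q : 'I_3 -> 'rV[R]_2) (w w' : seq 'I_3)
    i j i' j' :
  equidistant q -> size w = size w' -> i != j ->
  word_map q w (q i) = word_map q w' (q i') ->
  word_map q w (q j) = word_map q w' (q j') ->
  [/\ w = w', i = i' & j = j'].
Proof.
move=> /equidistant_sqdist[D D0 qD] sz ij ei ej.
have D1 : D != 0 by rewrite gt_eqF.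
have bv k l : bary q D k (q l) = (k == l)%:R by exact: bary_vertex.
have cons_bary k a v x : bary q D k (word_map q (a :: v) x)
    = (bary q D k (word_map q v x) + (k == a)%:R) / 2.
  by rewrite /= half_contractionE bary_half // bv.
have diff_bary k v x y : bary q D k (word_map q v x) - bary q D k (word_map q v y)
    = 2^-1 ^+ size v * (bary q D k x - bary q D k y).
  elim: v => [|a v IH]; first by rewrite expr0 mul1r.
  by rewrite !cons_bary exprS -mulrA -IH; field.
(* Both words scale by the same power of 1/2, so the two edge vectors agree before scaling; the
   signs of their barycentric coordinates identify [i] and [j]. *)
have [ii jj] : i = i' /\ j = j'.
  have e k : (k == i)%:R - (k == j)%:R = (k == i')%:R - (k == j')%:R :> R.
    apply: (@mulfI _ (2^-1 ^+ size w)); first by rewrite expf_neq0 // invr_neq0.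
    by rewrite {2}sz -!bv -!diff_bary ei ej.
  move: (e i) (e j); rewrite !eqxx (eq_sym j i) (negPf ij).
  case: (i =P i') => ?; case: (j =P j') => ?; case: (i == j'); case: (j == i');
    rewrite /= => e1 e2; by [split | exfalso; lra].
subst i' j'; split=> //.
have bounds v l k : 0 <= bary q D k (word_map q v (q l)) <= 1.
  elim: v => [|a v IH]; first by rewrite bv; case: (_ == _) => /=; lra.
  by rewrite cons_bary; case: (_ == _) => /=; lra.
have bary_gt0 v a : 0 < bary q D a (word_map q v (q a)).
  elim: v => [|b v IH]; first by rewrite bv eqxx.
  by rewrite cons_bary; case: (_ == _) => /=; lra.
have eqw k : word_map q w (q k) = word_map q w' (q k).
  apply: (@addIr _ (- word_map q w (q i))).
  by rewrite {2}ei !word_mapB sz.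
elim: w w' sz eqw {ei ej} => [|a w IH] [|a' w'] //= [sz] eqw.
have aa : a = a'.
  apply/eqP; apply: contraT => /negPf aa.
  have := congr1 (bary q D a) (eqw a).
  rewrite -![half_contraction _ _ _]/(word_map q (_ :: _) _) !cons_bary eqxx aa /=.
  have := bary_gt0 w a; have /andP[_] := bounds w' a a; lra.
subst a'; congr cons; apply: IH => // k.
move: (eqw k); rewrite !half_contractionE => /(@scalerI _ _ 2^-1).
by rewrite invr_eq0 pnatr_eq0 => /(_ isT)/addIr.
Qed.

(** * Energy cell by cell, and the 1/5-2/5 rule *)

Definition cell_energy {R : realType} (a : 'I_3 -> R) : R :=
  \sum_i \sum_j `|a i - a j| ^+ 2.

Definition cell_values {R : realType} (q : 'I_3 -> 'rV[R]_2) (u : 'rV[R]_2 -> R)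
    (w : seq 'I_3) (i : 'I_3) : R := u (word_map q w (q i)).

Lemma word_map_vertex_inj {R : realType} (q : 'I_3 -> 'rV[R]_2) w :
  equidistant q -> injective (fun i => word_map q w (q i)).
Proof.
move=> [qinj _] i j /eqP; rewrite -subr_eq0 word_mapB scaler_eq0.
rewrite expf_eq0 invr_eq0 pnatr_eq0 andbF subr_eq0 => /eqP; exact: qinj.
Qed.

(** An edge determines its cell and its ends ([word_edge_inj]), so ordered pairs of neighbors
    correspond to triples [(w, (i, j))] with [i != j]; the diagonal terms of [cell_energy]
    vanish. *)
Lemma energyE {R : realType} (q : 'I_3 -> 'rV[R]_2) m u :
  equidistant q ->
  energy q m u = (5 / 3) ^+ m *
    (2^-1 * \sum_(w : m.-tuple 'I_3) cell_energy (cell_values q u w)).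
Proof.
move=> eq_q; rewrite /energy; congr (_ * (_ * _)).
pose edge (t : m.-tuple 'I_3 * ('I_3 * 'I_3)) :=
  (word_map q t.1 (q t.2.1), word_map q t.1 (q t.2.2)).
rewrite (reindex_fsbig edge [set` [pred t | t.2.1 != t.2.2]]); last first.
  split.
  - move=> [w [i j]] /= ij.
    have inV k : vertices q m (word_map q w (q k)).
      by exists w => //; exists (q k).
    split => //=; first by apply: contra_neq ij => /(word_map_vertex_inj _ _ eq_q).
    by exists w; split; [exists (q i) | exists (q j)].
  - move=> [w [i j]] [w' [i' j']] /set_mem /= ij _ [ei ej].
    have [|ew <- <-] := word_edge_inj _ w w' _ _ _ _ eq_q _ ij ei ej.
      by rewrite !size_tuple.
    by rewrite (val_inj ew).
  - move=> [x y] [/= _ _ xy [w [[_ [i _ <-] ex] [_ [j _ <-] ey]]]].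
    exists (w, (i, j)) => /=; last by rewrite /edge /= ex ey.
    by apply: contra_neq xy => /= ij; rewrite -ex -ey ij.
rewrite -(@bigfs _ _ _ _ (index_enum _)) ?index_enum_uniq //; last first.
  by move=> t _; rewrite mem_index_enum.
rewrite big_mkcond /= -(pair_bigA _
  (fun (w : m.-tuple 'I_3) (p : 'I_3 * 'I_3) => if p.1 != p.2 then
  `|u (word_map q w (q p.1)) - u (word_map q w (q p.2))| ^+ 2 else 0)) /=.
apply: eq_bigr => w _; rewrite -(pair_bigA _ (fun i j : 'I_3 => if i != j then
  `|u (word_map q w (q i)) - u (word_map q w (q j))| ^+ 2 else 0)) /=.
apply: eq_bigr => i _; apply: eq_bigr => j _.
by case: eqP => //= ->; rewrite subrr normr0 expr0n.
Qed.

Lemma big_tuple_rcons {R : realType} {T : finType} m (F : seq T -> R) :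
  \sum_(w : m.+1.-tuple T) F w = \sum_(w : m.-tuple T) \sum_k F (rcons w k).
Proof.
rewrite pair_bigA /=.
rewrite (reindex (fun p : m.-tuple T * T => [tuple of rcons p.1 p.2])) //=.
apply/onW_bij/inj_card_bij => [[v i] [w j] /(congr1 val)|] /=.
  by case/rcons_inj => /val_inj-> ->.
by rewrite card_prod !card_tuple expnSr.
Qed.

Lemma word_map_rcons {R : realType} (q : 'I_3 -> 'rV[R]_2) w k x :
  word_map q (rcons w k) x = word_map q w (half_contraction q k x).
Proof. by rewrite -cats1 word_map_cat. Qed.

(** The subcells [i] and [j] share the midpoint of the edge between the vertices [i] and [j]. *)
Lemma cell_values_rconsC {R : realType} (q : 'I_3 -> 'rV[R]_2) u w i j :
  cell_values q u (rcons w i) j = cell_values q u (rcons w j) i.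
Proof.
by rewrite /cell_values !word_map_rcons !half_contractionE addrC.
Qed.

Lemma cell_values_rcons_diag {R : realType} (q : 'I_3 -> 'rV[R]_2) u w i :
  cell_values q u (rcons w i) i = cell_values q u w i.
Proof.
by rewrite /cell_values !word_map_rcons /half_contraction subrr scaler0 add0r.
Qed.

(* [(a i + a j + \sum_k a k) / 5] is the 1/5-2/5 rule, without naming the third
   vertex. *)
Definition midpoint_defect {R : realType} (a : 'I_3 -> R) (b : 'I_3 -> 'I_3 -> R)
    i j : R := b i j - (a i + a j + \sum_k a k) / 5.

(** The rule is the critical point of the subdivided energy for fixed corner values [a], so the
    cross terms vanish and [E] is the renormalised energy of the defects, taken as 0 at the
    corners. *)
Lemma cell_energy_subdivision {R : realType} (a : 'I_3 -> R)
    (b : 'I_3 -> 'I_3 -> R) :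
  (forall i j, b i j = b j i) -> (forall i, b i i = a i) ->
  exists2 E, 5 / 3 * \sum_k cell_energy (b k) = cell_energy a + E &
    (0 <= E) /\ (E = 0 -> forall i j, i != j -> midpoint_defect a b i j = 0).
Proof.
move=> bC bd.
pose x := midpoint_defect a b (inord 1) (inord 2).
pose y := midpoint_defect a b (inord 0) (inord 2).
pose z := midpoint_defect a b (inord 0) (inord 1).
(* Each midpoint is joined to two corners and to the two other midpoints; 10/3 is 5/3 times 2, as
   pairs are ordered. *)
exists (10 / 3 * (2 * (x ^+ 2 + y ^+ 2 + z ^+ 2) +
  (x - y) ^+ 2 + (y - z) ^+ 2 + (z - x) ^+ 2)); last split.
- rewrite /x /y /z /midpoint_defect /cell_energy !big_ord3.
  rewrite !real_normK ?num_real // !bd.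
  rewrite (bC (inord 1) (inord 0)) (bC (inord 2) (inord 0)) (bC (inord 2) (inord 1)).
  by field.
- have := sqr_ge0 x; have := sqr_ge0 y; have := sqr_ge0 z.
  have := sqr_ge0 (x - y); have := sqr_ge0 (y - z); have := sqr_ge0 (z - x).
  by move: x y z => x y z; lra.
- move=> E0.
  have [x0 y0 z0] : [/\ x = 0, y = 0 & z = 0].
    move: x y z E0 => x y z E0.
    have := sqr_ge0 x; have := sqr_ge0 y; have := sqr_ge0 z.
    have := sqr_ge0 (x - y); have := sqr_ge0 (y - z); have := sqr_ge0 (z - x).
    by split; apply/eqP; rewrite -(@sqrf_eq0 R); apply/eqP; lra.
  have dC i j : midpoint_defect a b i j = midpoint_defect a b j i.
    by rewrite /midpoint_defect bC (addrC (a i)).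
  by apply: ord3_ind; apply: ord3_ind; rewrite ?eqxx // dC.
Qed.

(** Equality of consecutive energies makes the excesses of the cells of one level sum to 0; being
    nonnegative, each of them vanishes. *)
Lemma harmonic_rule {R : realType} (q : 'I_3 -> 'rV[R]_2) S h :
  equidistant q -> harmonic_on q S h ->
  forall w i j, i != j -> cell_values q h (rcons w i) j =
    (cell_values q h w i + cell_values q h w j + \sum_k cell_values q h w k) / 5.
Proof.
move=> eq_q [_ hE] w i j ij.
have sub v := cell_energy_subdivision (cell_values q h v)
  (fun k => cell_values q h (rcons v k)) (cell_values_rconsC q h v)
  (cell_values_rcons_diag q h v).
have /choice[E EP] v : exists E, [/\ 5 / 3 * \sum_k cell_energy
    (cell_values q h (rcons v k)) = cell_energy (cell_values q h v) + E,
    0 <= E & E = 0 -> forall i j, i != j -> midpoint_defect (cell_values q h v)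
      (fun k => cell_values q h (rcons v k)) i j = 0].
  by have [E ? []] := sub v; exists E.
have sumE0 : \sum_(v : (size w).-tuple 'I_3) E v = 0.
  have := hE (size w); rewrite !energyE // exprSr -mulrA => /mulfI.
  rewrite expf_neq0 ?mulf_neq0 ?invr_neq0 ?pnatr_eq0 // => /(_ isT).
  rewrite mulrCA => /mulfI; rewrite invr_neq0 ?pnatr_eq0 // => /(_ isT).
  rewrite (big_tuple_rcons _ (fun v => cell_energy (cell_values q h v))).
  rewrite mulr_sumr (eq_bigr (fun v : (size w).-tuple 'I_3 =>
    cell_energy (cell_values q h v) + E v)); last by move=> v _; case: (EP v).
  by rewrite big_split /= -[RHS]addr0 => /addrI.
have [_ _ +] := EP w => /(_ _ i j ij) rule.
apply/eqP; rewrite -subr_eq0; apply/eqP/rule.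
move/eqP: sumE0; rewrite psumr_eq0; last by move=> v _; case: (EP v).
by move=> /allP/(_ (in_tuple w)); rewrite mem_index_enum => /(_ isT)/eqP.
Qed.

(** * One subdivision step: maximum principle and contraction *)

Section MidpointRule.
Context {R : realType} (a b : 'I_3 -> R) (k : 'I_3).
Hypothesis bk : b k = a k.
Hypothesis bj : forall j, k != j -> b j = (a k + a j + \sum_i a i) / 5.

Lemma midpoint_rule_range c d : (forall i, c <= a i <= d) ->
  forall j, c <= b j <= d.
Proof.
move=> cad j; have [<-|kj] := eqVneq k j; first by rewrite bk.
rewrite bj // big_ord3.
have := cad k; have := cad j.
have := cad (inord 0); have := cad (inord 1); have := cad (inord 2); lra.
Qed.

(** With [l] the third index, [b k - b j] is [(2 (a k - a j) + (a k - a l)) / 5], which gives 3/5;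
    between the two midpoints the difference is only [(a j - a l) / 5]. *)
Lemma midpoint_rule_osc (M : R) : (forall i j, a i - a j <= M) ->
  forall i j, b i - b j <= M * (3 / 5).
Proof.
move=> aM.
have := (aM (inord 0) (inord 1), aM (inord 1) (inord 0), aM (inord 0) (inord 2),
  aM (inord 2) (inord 0), aM (inord 1) (inord 2), aM (inord 2) (inord 1)).
have n01 : inord 0 != inord 1 :> 'I_3 by rewrite -val_eqE /= !inordK.
have n02 : inord 0 != inord 2 :> 'I_3 by rewrite -val_eqE /= !inordK.
have n12 : inord 1 != inord 2 :> 'I_3 by rewrite -val_eqE /= !inordK.
have := aM k k; rewrite subrr => M0.
case=> [[[[[h01 h10] h02] h20] h12] h21].
move: k bk bj; apply: ord3_ind => ek ej;
  apply: ord3_ind; apply: ord3_ind;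
  rewrite ?subrr ?ek ?ej ?big_ord3 // 1?eq_sym //; lra.
Qed.

End MidpointRule.

Lemma exp_half_small {R : realType} (C e : R) : 0 < e -> exists n, 2^-1 ^+ n * C < e.
Proof.
move=> e0; exists (Num.truncn (C / e)).+1.
rewrite exprVn mulrC ltr_pdivrMr ?exprn_gt0 // -ltr_pdivrMl // mulrC.
rewrite (lt_trans (truncnS_gt _)) //.
by rewrite -natrX ltr_nat ltn_expl.
Qed.

(** * Addresses and vertices in the gasket *)

Section GasketPoints.
Context {R : realType} (q : 'I_3 -> 'rV[R]_2) (S : set 'rV[R]_2).
Hypothesis gasketS : is_gasket q S.

Lemma gasket_word w x : S x -> S (word_map q w x).
Proof.
case: gasketS => _ _ eS Sx; elim: w => //= i w IH.
by rewrite eS; exists i => //; exists (word_map q w x).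
Qed.

Lemma gasket_address n x : S x ->
  exists (w : n.-tuple 'I_3), exists2 y, S y & x = word_map q w y.
Proof.
case: gasketS => _ _ eS; elim: n x => [|n IH] x Sx.
  by exists [tuple]; exists x.
move: Sx; rewrite {1}eS => -[i _ [y /IH[w [z Sz ->]] <-]].
by exists [tuple of i :: w]; exists z.
Qed.

(** [q i] is the fixed point of the [i]-th contraction, hence the limit of its iterates at any point
    of the closed set [S]. *)
Lemma gasket_vertex i : S (q i).
Proof.
have [[x Sx] cS _] := gasketS.
apply: (compact_closed _ cS); first exact: norm_hausdorff.
move=> B /nbhs_ballP[e /= e0 qB].
have [n ne] := exp_half_small `|q i - x| e e0.
exists (word_map q (nseq n i) x); split; first exact: gasket_word.
have fix_q : word_map q (nseq n i) (q i) = q i.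
  elim: n {ne} => //= n ->.
  by rewrite /half_contraction subrr scaler0 add0r.
apply: qB; rewrite -ball_normE /ball_ /= -{1}fix_q word_mapB normrZ size_nseq.
by rewrite ger0_norm // exprn_ge0 // invr_ge0.
Qed.

Lemma gasket_bounded : exists2 B, 0 < B & forall x y, S x -> S y -> `|x - y| <= B.
Proof.
have [_ cS _] := gasketS; have [B [_ SB]] := compact_bounded cS.
exists (2 * (`|B| + 1)).
  by rewrite mulr_gt0 // ltr_wpDl.
have {}SB x : S x -> `|x| <= `|B| + 1.
  by apply: SB; rewrite (le_lt_trans (ler_norm B)) // ltrDl.
move=> x y /SB xB /SB yB; rewrite (le_trans (ler_normB _ _)) //.
by rewrite mulr_natl mulr2n lerD.
Qed.

End GasketPoints.

(** * Oscillation of a harmonic function over a cell *)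

Section HarmonicOscillation.
Context {R : realType} (q : 'I_3 -> 'rV[R]_2) (S : set 'rV[R]_2)
  (h : 'rV[R]_2 -> R).
Hypothesis eq_q : equidistant q.
Hypothesis gasketS : is_gasket q S.
Hypothesis harm : harmonic_on q S h.

Lemma harmonic_vertex_osc (M : R) :
  (forall i j, h (q i) - h (q j) <= M) ->
  forall w i j, cell_values q h w i - cell_values q h w j <= M * (3 / 5) ^+ size w.
Proof.
move=> hM; elim/last_ind => [|w k IH].
  by move=> i j; rewrite expr0 mulr1; exact: hM.
rewrite size_rcons exprSr (mulrA M).
apply: (midpoint_rule_osc _ _ k _ _ _ IH).
  exact: cell_values_rcons_diag.
exact: (harmonic_rule q S h).
Qed.

Lemma harmonic_vertex_range w c d :
  (forall i, c <= cell_values q h w i <= d) ->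
  forall v i, c <= cell_values q h (w ++ v) i <= d.
Proof.
move=> cd; elim/last_ind => [|v k IH]; first by rewrite cats0.
rewrite -rcons_cat.
apply: (midpoint_rule_range _ _ k _ _ _ _ IH); first exact: cell_values_rcons_diag.
exact: (harmonic_rule q S h).
Qed.

(* Vertices are dense in the gasket, so the maximum principle at the vertices
   passes to the whole cell by continuity. *)
Lemma harmonic_cell_range w c d :
  (forall i, c <= cell_values q h w i <= d) ->
  forall y, S y -> c <= h (word_map q w y) <= d.
Proof.
move=> cd y Sy; have [hcont _] := harm.
suff approx e : 0 < e -> exists2 t, c <= t <= d & `|h (word_map q w y) - t| < e.
  by apply/andP; split; apply/ler_addgt0Pr => e /approx[t /andP[ct td]];
    rewrite ltr_norml => /andP[]; lra.
move=> e0; have Swy := gasket_word q S gasketS w y Sy.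
have /subspace_continuousP/(_ _ Swy)/cvgrPdist_lt/(_ _ e0) := hcont.
rewrite /within /= => /nbhs_ballP[r /= r0 near_y].
have [B B0 SB] := gasket_bounded q S gasketS.
have [n nr] := exp_half_small B r r0.
have [v [z Sz yz]] := gasket_address q S gasketS n y Sy.
(* [v] begins an address of [y], so this vertex lies in the same small subcell as [word_map q w y],
   at distance at most [2^-n B]. *)
exists (cell_values q h (w ++ v) ord0); first exact: harmonic_vertex_range.
apply: near_y; last exact: (gasket_word q S gasketS _ _ (gasket_vertex q S gasketS _)).
rewrite -ball_normE /ball_ /= yz -word_map_cat word_mapB normrZ.
rewrite ger0_norm ?exprn_ge0 ?invr_ge0 // size_cat size_tuple exprD.
have half_ge0 k : 0 <= 2^-1 ^+ k :> R by rewrite exprn_ge0 // invr_ge0.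
apply: le_lt_trans nr; rewrite -mulrA.
have le_B : 2^-1 ^+ n * `|z - q ord0| <= 2^-1 ^+ n * B.
  by rewrite ler_wpM2l //; apply: SB => //; exact: (gasket_vertex q S).
apply: le_trans le_B; rewrite ler_piMl ?mulr_ge0 //.
by rewrite exprn_ile1 ?invr_ge0 // invf_le1 // ler1n.
Qed.

End HarmonicOscillation.

(** * Coverings and box dimension *)

Lemma covered_by_finType {R : realType} {n} {T : finType} (U : T -> set 'rV[R]_n)
    (d : R) (F : set 'rV[R]_n) :
  (forall t, (diam (U t) <= d%:E)%E) -> F `<=` \bigcup_t U t ->
  Defs.covered_by d F #|T|.
Proof.
move=> Ud FU; exists (fun i => U (enum_val i)); split=> [i|x /FU[t _ Ux]].
  exact: Ud.
by exists (enum_rank t) => //; rewrite enum_rankK.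
Qed.

Lemma diam_le {R : realType} {n} (A : set 'rV[R]_n) (e : R) : 0 <= e ->
  (forall x y i, A x -> A y -> `|x 0 i - y 0 i| <= e) ->
  (diam A <= (n%:R * e)%:E)%E.
Proof.
move=> e0 Ae; apply: ge_ereal_sup => _ [[x y] [/= Ax Ay] <-].
rewrite lee_fin /eucl_dist -[leRHS]ger0_norm ?mulr_ge0 // -sqrtr_sqr.
rewrite ler_wsqrtr //.
apply: (@le_trans _ _ (\sum_(i < n) e ^+ 2)).
  by apply: ler_sum => i _; rewrite -real_normK ?num_real // lerXn2r ?nnegrE // Ae.
(* The factor [n] is cruder than its square root, but constants do not affect the dimension. *)
rewrite sumr_const card_ord exprMn -[leLHS]mulr_natl ler_wpM2r ?sqr_ge0 //.
by rewrite -natrX ler_nat; case: (n) => // k; rewrite expnS leq_pmulr.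
Qed.

Lemma lne_le_ln {R : realType} (x : \bar R) (y : R) : 0 < y ->
  (x <= y%:E)%E -> (lne x <= (ln y)%:E)%E.
Proof.
case: x => [r| |] //= y0; rewrite ?lee_fin ?leNye //.
by case: ifPn => [_|]; rewrite ?leNye // -ltNge lee_fin => r0; rewrite ler_ln.
Qed.

Lemma covering_number_le {R : realType} {n} (F : set 'rV[R]_n) (d d' : R) k :
  d <= d' -> Defs.covered_by d F k -> (covering_number d' F <= k%:R%:E)%E.
Proof.
move=> dd' [U [Ud FU]]; apply: ereal_inf_lbound; exists k => //.
exists U; split=> // i; apply: le_trans (Ud i) _; by rewrite lee_fin.
Qed.

(** Every small [d] is within a factor 2 of some scale [C 2^-m]; this costs one factor [r], which
    disappears with [K] and [C] on division by [- ln d]. *)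
Lemma upper_box_dim_le {R : realType} {n} (F : set 'rV[R]_n) (C K r : R) :
  0 < C -> 0 < K -> 1 <= r ->
  (forall m, exists2 k, Defs.covered_by (C * 2^-1 ^+ m) F k & k%:R <= K * r ^+ m) ->
  (upper_box_dim F <= (ln r / ln 2)%:E)%E.
Proof.
have add_bounds (x y z u v w : R) :
  x + y + z < w -> u <= y + z + v -> x + u <= v + w by lra.
move=> C0 K0 r1 cov; have r0 : 0 < r := lt_le_trans ltr01 r1.
have ln2 : 0 < ln 2 :> R by rewrite ln_gt0 // ltr1n.
have lnr : 0 <= ln r by rewrite ln_ge0.
set s := ln r / ln 2.
apply/lee_addgt0Pr => e e0.
pose K' := ln K + ln r + s * ln C.
(* For [L = - ln d] above these bounds, respectively, [L] is positive, the constant [K'] is below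
   [e L], and [t] below is nonnegative. *)
pose L0 := Num.max 1 (Num.max (K' / e) (- ln C)).
apply: (@le_trans _ _ (ereal_sup ((fun d : R =>
    (lne (covering_number d F) / (- ln d)%:E)%E) @` [set d | 0 < d < expR (- L0)]))).
  apply: ereal_inf_lbound; exists [set d | 0 < d < expR (- L0)] => //.
  near=> d; apply/andP; split; near: d; first exact: nbhs_right_gt.
  by apply: nbhs_right_lt; rewrite expR_gt0.
apply: ge_ereal_sup => _ [d /andP[d0 dL] <-].
have {dL} : L0 < - ln d.
  by rewrite ltrNr -[ltRHS]expRK ltr_ln ?posrE ?expR_gt0.
set L := - ln d; rewrite /L0 !gt_max => /and3P[L1 LK LC].
have Lpos : 0 < L := lt_trans ltr01 L1.
rewrite inver gt_eqF // lee_pdivrMr // -EFinD -EFinM.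
(* [t] is the real solution of [C 2^-t = d]; rounding up gives [C 2^-m <= d] with [m <= t + 1]. *)
pose t := (ln C + L) / ln 2; pose m := (Num.truncn t).+1.
have t0 : 0 <= t by rewrite divr_ge0 ?(ltW ln2) //; lra.
have [k kcov kK] := cov m.
have Cd : C * 2^-1 ^+ m <= d.
  rewrite exprVn ler_pdivrMr ?exprn_gt0 // -ler_ln ?posrE ?mulr_gt0 ?exprn_gt0 //.
  rewrite lnM ?posrE ?exprn_gt0 // lnXn // -[ln 2 *+ m]mulr_natl.
  rewrite -lerBlDl -ler_pdivrMr //; exact/ltW/truncnS_gt.
apply: (@le_trans _ _ (ln (K * r ^+ m))%:E).
  apply: lne_le_ln; first by rewrite mulr_gt0 ?exprn_gt0.
  by apply: le_trans (covering_number_le _ _ _ _ Cd kcov) _; rewrite lee_fin.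
rewrite lee_fin lnM ?posrE ?exprn_gt0 // lnXn // -mulr_natl.
have mt : m%:R * ln r <= ln r + s * ln C + s * L.
  have -> : ln r + s * ln C + s * L = (t + 1) * ln r.
    by rewrite /t /s; field; rewrite gt_eqF.
  by rewrite ler_wpM2r // /m -natr1 lerD2r truncn_le.
move: LK; rewrite ltr_pdivrMr // mulrC => LK.
by rewrite [leRHS]mulrDl; exact: add_bounds LK mt.
Unshelve. all: by end_near. Qed.

(** * Covering the graph *)

Lemma ler_row_norm {R : realType} {n} (x : 'rV[R]_n) i : `|x 0 i| <= `|x|.
Proof.
rewrite [leRHS]mx_normrE.
exact: (le_bigmax _ (fun ij : 'I_1 * 'I_n => `|x ij.1 ij.2|) (0, i)).
Qed.

(* Over a cell of level [m] the graph has height at most [2 M (3/5)^m], which is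
   cut into [(6/5)^m + 1] slices of height [2 M 2^-m]. *)
Lemma harmonic_graph_cover {R : realType} (q : 'I_3 -> 'rV[R]_2) S h :
  equidistant q -> is_gasket q S -> harmonic_on q S h ->
  exists2 C, 0 < C & forall m, exists2 k,
    Defs.covered_by (C * 2^-1 ^+ m) (graph_on S h) k & k%:R <= 2 * (18 / 5) ^+ m :> R.
Proof.
move=> eq_q gS harm; have [B B0 SB] := gasket_bounded q S gS.
(* The summand 1 keeps [M], and so the slice height [s], positive even when [h] vanishes at all
   three vertices. *)
pose M := 1 + 2 * \sum_i `|h (q i)|.
have hM i j : h (q i) - h (q j) <= M.
  have leS k : `|h (q k)| <= \sum_i `|h (q i)|.
    by rewrite (bigD1 k) //= lerDl sumr_ge0.
  rewrite /M; have := leS i; have := leS j.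
  by have := ler_norm (h (q i)); have := ler_norm (- h (q j)); rewrite normrN; lra.
have M0 : 0 < M.
  by rewrite /M ltr_pwDl // mulr_ge0 // sumr_ge0.
(* 3 is the dimension factor of [diam_le]; [B] accounts for the horizontal extent and [2 M] for the
   slice height. *)
exists (3 * (B + 2 * M)) => [|m]; first by rewrite mulr_gt0 // addr_gt0 // mulr_gt0.
pose s := 2 * M * 2^-1 ^+ m.
have s0 : 0 < s by rewrite !mulr_gt0 // exprn_gt0 // invr_gt0.
pose c (w : m.-tuple 'I_3) := cell_values q h w ord0 - M * (3 / 5) ^+ m.
pose slice w x := Num.truncn ((h x - c w) / s).
(* Slices are numbered from 0 up to the integer part of [(6/5)^m], inclusive. *)
pose N := (Num.truncn ((6 / 5) ^+ m : R)).+1.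
have range (w : m.-tuple 'I_3) y : S y -> 0 <= (h (word_map q w y) - c w) / s <= (6 / 5) ^+ m.
  move=> Sy; have osc i : cell_values q h w ord0 - M * (3 / 5) ^+ m
      <= cell_values q h w i <= cell_values q h w ord0 + M * (3 / 5) ^+ m.
    have := harmonic_vertex_osc q S h eq_q harm M hM w i ord0.
    have := harmonic_vertex_osc q S h eq_q harm M hM w ord0 i.
    by rewrite size_tuple; lra.
  have /andP[lo hi] := harmonic_cell_range q S h eq_q gS harm w _ _ osc y Sy.
  rewrite divr_ge0 ?subr_ge0 ?(ltW s0) //= ler_pdivrMr // /s mulrCA -exprMn.
  have -> : 6 / 5 * 2^-1 = 3 / 5 :> R by field.
  by rewrite /c; lra.
pose U (p : m.-tuple 'I_3 * 'I_N) : set 'rV[R]_3 :=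
  (fun x => row_mx x (h x)%:M : 'rV[R]_(2 + 1)) @`
    [set x | (word_map q p.1 @` S) x /\ slice p.1 x = p.2].
exists #|{: m.-tuple 'I_3 * 'I_N}|; last first.
  rewrite card_prod card_tuple !card_ord natrM natrX.
  have -> : 18 / 5 = 3 * (6 / 5) :> R by field.
  rewrite exprMn mulrCA ler_wpM2l ?exprn_ge0 // /N -natr1.
  (* This absorbs the extra slice: [N <= 2 (6/5)^m]. *)
  have : 1 <= (6 / 5) ^+ m :> R by rewrite exprn_ege1 //; lra.
  by have := truncn_le ((6 / 5) ^+ m : R); rewrite exprn_ge0 //; lra.
apply: (covered_by_finType U) => [[w j]|_ [x Sx <-]]; last first.
  have [w [y Sy ->]] := gasket_address q S gS m x Sx.
  have /andP[_ wy] := range w y Sy.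
  have lt_N : (slice w (word_map q w y) < N)%N by rewrite ltnS le_truncn.
  by exists (w, Ordinal lt_N) => //; exists (word_map q w y) => //; split => //; exists y.
rewrite -mulrA; apply: diam_le.
  by rewrite mulr_ge0 ?exprn_ge0 ?invr_ge0 // addr_ge0 ?mulr_ge0 ?ltW.
move=> _ _ i [_ [[x Sx <-] /= jx] <-] [_ [[y Sy <-] /= jy] <-].
have half_ge0 : 0 <= 2^-1 ^+ m :> R by rewrite exprn_ge0 // invr_ge0.
have rowl z k : (row_mx z (h z)%:M : 'rV[R]_3) 0 (@lshift 2 1 k) = z 0 k.
  exact: (@row_mxEl _ 1 2 1).
have rowr z k : (row_mx z (h z)%:M : 'rV[R]_3) 0 (@rshift 2 1 k) = h z.
  by rewrite (@row_mxEr _ 1 2 1) mxE ord1.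
case: (@split_ordP 2 1 i) => k ->; rewrite ?rowl ?rowr mulrDl.
  have := ler_row_norm (word_map q w x - word_map q w y) k; rewrite !mxE.
  move=> /le_trans; apply; rewrite word_mapB normrZ ger0_norm // size_tuple mulrC.
  by rewrite ler_wpDr ?mulr_ge0 ?(ltW M0) // ler_wpM2r // SB.
rewrite ler_wpDl ?mulr_ge0 ?(ltW B0) // -/s.
have := truncn_itv (proj1 (andP (range w x Sx))).
rewrite -/(slice w (word_map q w x)) jx -natr1 => /andP[xl xr].
have := truncn_itv (proj1 (andP (range w y Sy))).
rewrite -/(slice w (word_map q w y)) jy -natr1 => /andP[yl yr].
set hx := h _ in xl xr *; set hy := h _ in yl yr *.
(* Both quotients have integer part [j], so they differ by less than 1. *)
have -> : hx - hy = ((hx - c w) / s - (hy - c w) / s) * s.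
  by field; rewrite gt_eqF.
rewrite normrM (gtr0_norm s0) ler_piMl ?(ltW s0) // ler_norml; lra.
Qed.

Theorem theorem5p2 (R : realType) (q : 'I_3 -> 'rV[R]_2) (S : set 'rV[R]_2)
    (h : 'rV[R]_2 -> R) :
  equidistant q -> is_gasket q S -> harmonic_on q S h ->
  (upper_box_dim (graph_on S h) <= (ln (18 / 5) / ln 2)%:E)%E.
Proof.
move=> eq_q gS harm; have [C C0 cov] := harmonic_graph_cover q S h eq_q gS harm.
by apply: (upper_box_dim_le _ C 2) => //; lra.
Qed.
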